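(* For all integers $n,m\geq 0$ and every $A\subset\partial\Gamma_{n,m}$ we have $$|\mathrm{Split}_2^{(2)}(A)|\geq|A|-(2^n+2^m-1).$$
   Context: $T_n=\{0,1\}^{\leq n}$ is the set of binary words of length at most $n$, ordered by $u\preceq v$ iff $u$ is a prefix of $v$ (possibly $u=v$); its leaves are $\partial T_n=\{0,1\}^n$. For $n,m\geq0$ let $\Gamma_{n,m}=T_n\times T_m$ with $(u,v)\preceq_2(x,y)$ iff $u\preceq x$ and $v\preceq y$, and let $\partial\Gamma_{n,m}=\partial T_n\times\partial T_m$. For $A\subset\partial\Gamma_{n,m}$ the ancestor closure is $\Gamma_A=\{(u,v)\in\Gamma_{n,m}:(u,v)\preceq_2(x,y)\text{ for some }(x,y)\in A\}$. A vertex $(u,v)\in\Gamma_A$ splits if $(u\varepsilon,v\delta)\in\Gamma_A$ for every $(\varepsilon,\delta)\in\{0,1\}^2$ (juxtaposition denotes concatenation), and $\mathrm{Split}_2^{(2)}(A)$ is the set of all vertices of $\Gamma_A$ which split. *)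

(* Defs.v *)
From mathcomp Require Import all_boot.
Set Implicit Arguments.
Unset Strict Implicit.
Unset Printing Implicit Defensive.

(* T_n, the binary words of length at most n; the order on it is [prefix],
   which is reflexive. *)
Definition tree (n : nat) : finType := n.-bseq bool.

Definition leaves (n : nat) : {set tree n} := [set u : tree n | size u == n].

Definition bitree (n m : nat) : finType := (tree n * tree m)%type.

Definition preceq2 (n m : nat) (p q : bitree n m) : bool :=
  prefix p.1 q.1 && prefix p.2 q.2.

Definition bileaves (n m : nat) : {set bitree n m} :=
  setX (leaves n) (leaves m).

Definition anc_closure (n m : nat) (A : {set bitree n m}) : {set bitree n m} :=
  [set p | [exists a in A, preceq2 p a]].

(* [rcons u e] is the word u followed by the letter e; it need not have length
   at most n, so membership of the extended pair in the closure is expressed by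
   an element q of the closure whose components are the extended words. *)
Definition splits (n m : nat) (A : {set bitree n m}) (p : bitree n m) : bool :=
  [forall e : bool, forall d : bool, exists q in anc_closure A,
     (rcons p.1 e == q.1 :> seq bool) && (rcons p.2 d == q.2 :> seq bool)].

Definition Split2 (n m : nat) (A : {set bitree n m}) : {set bitree n m} :=
  [set p in anc_closure A | splits A p].

(* Main.v *)
Require Import Defs.
From mathcomp Require Import all_boot all_order all_algebra.
From mathcomp Require Import zify.
Set Implicit Arguments.
Unset Strict Implicit.
Unset Printing Implicit Defensive.

Import Order.TTheory GRing.Theory Num.Theory.
Local Open Scope ring_scope.

(** Write [1_u (x) 1_v] for the function on [A] whose value at [(x, y)] is [1]
    when [u] is a prefix of [x] and [v] is a prefix of [y], and [0] otherwise.
    The inequality is a dimension count in the space of rational functions on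
    [A], which has dimension [#|A|].

    It is enough to see that this space is spanned by the following functions:
    the constant [1]; [1_(u1) (x) 1] for [u] a word of length less than [n];
    [1 (x) 1_(v1)] for [v] a word of length less than [m]; and
    [1_(u1) (x) 1_(v1)] for [(u, v)] a splitting vertex.  There are
    [1 + (2^n - 1) + (2^m - 1) + #|Split2 A|] of them.

    The span contains every [1_u (x) 1_v], by induction on [u] and [v]
    (lemma [ind_in_span]).  Since [1_u = 1_(u0) + 1_(u1)] in each factor
    (lemmas [ind_rconsl] and [ind_rconsr]), the four functions
    [1_(ue) (x) 1_(vd)] agree up to sign modulo the functions with a shorter
    word in one of the factors, so one of the four in the span brings in the
    others.  If [(u, v)] splits, one of the four is a generator; if it does
    not split, then some quadrant [(ue, vd)] contains no point of [A], and the
    corresponding function is [0] (lemma [ind_eq0_of_not_splits]).  Finally,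
    the indicator of a single point [(x, y)] of [A] is [1_x (x) 1_y]. *)

Fixpoint words_lt (n : nat) : seq (seq bool) :=
  if n is n'.+1 then
    [::] :: map (cons true) (words_lt n') ++ map (cons false) (words_lt n')
  else [::].

Lemma size_words_lt n : (size (words_lt n)).+1 = (2 ^ n)%N.
Proof.
elim: n => //= n IHn.
by rewrite size_cat !size_map expnS mul2n -addnn -IHn addSn addnS.
Qed.

Lemma mem_words_lt n (u : seq bool) : (size u < n)%N -> u \in words_lt n.
Proof.
elim: n u => [|n IHn] [|b u] //= ltun; rewrite in_cons /= mem_cat.
have {}IHn : u \in words_lt n by apply: IHn.
by case: b; rewrite map_f // orbT.
Qed.

Lemma prefix_rcons_split (u x : seq bool) : (size u < size x)%N ->
  prefix u x = (prefix (rcons u true) x + prefix (rcons u false) x)%N :> nat.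
Proof.
elim: u x => [|b u IHu] [|c x] //=; first by case: c; rewrite prefix0s.
by rewrite ltnS => /IHu; case: eqP => //= _.
Qed.

Lemma prefix_eq_size (T : eqType) (u x : seq T) :
  size u = size x -> prefix u x = (u == x).
Proof. by move=> eq_ux; rewrite prefixE eq_ux take_size eq_sym. Qed.

Section Spanning.

Variables (n m : nat) (A : {set bitree n m}).
Hypothesis hA : A \subset bileaves n m.

(** The function [1_u (x) 1_v] on [A], as a row vector over an enumeration of
    [A].  The words are plain sequences, so that extending them by a letter
    needs no bound on the length. *)
Definition ind (u v : seq bool) : 'rV[rat]_#|A| :=
  \row_i (let a : bitree n m := enum_val i in
          prefix u a.1 && prefix v a.2)%:R.

Definition gens : seq 'rV[rat]_#|A| :=
  ind [::] [::]
    :: [seq ind (rcons u true) [::] | u <- words_lt n]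
    ++ [seq ind [::] (rcons v true) | v <- words_lt m]
    ++ [seq ind (rcons p.1 true) (rcons p.2 true)
         | p : bitree n m <- enum (Split2 A)].

Lemma size_leaf (a : bitree n m) :
  a \in A -> size a.1 = n /\ size a.2 = m.
Proof.
by move/(subsetP hA); rewrite !inE => /andP[/eqP -> /eqP ->].
Qed.

Lemma ind_rconsl (u v : seq bool) (e : bool) : (size u < n)%N ->
  ind (rcons u e) v = ind u v - ind (rcons u (~~ e)) v.
Proof.
move=> ltun; apply/rowP => i; rewrite !mxE.
case: (enum_val i) (size_leaf (enum_valP i)) => x y /= [sz1 _].
have := @prefix_rcons_split u x; rewrite sz1 => /(_ ltun).
by case: e; case: (prefix v _); rewrite ?andbT ?andbF ?subr0 // => ->;
  rewrite natrD ?addrK // addrC addKr.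
Qed.

Lemma ind_rconsr (u v : seq bool) (d : bool) : (size v < m)%N ->
  ind u (rcons v d) = ind u v - ind u (rcons v (~~ d)).
Proof.
move=> ltvm; apply/rowP => i; rewrite !mxE.
case: (enum_val i) (size_leaf (enum_valP i)) => x y /= [_ sz2].
have := @prefix_rcons_split v y; rewrite sz2 => /(_ ltvm).
by case: d; case: (prefix u _); rewrite ?subr0 //= => ->;
  rewrite natrD ?addrK // addrC addKr.
Qed.

(** A quadrant that contains a point of [A] has its root in the ancestor
    closure, so a vertex all of whose quadrants meet [A] splits. *)
Lemma ind_eq0_of_not_splits (p : bitree n m) :
  ~~ splits A p -> exists e d, ind (rcons p.1 e) (rcons p.2 d) = 0.
Proof.
case/forallPn => e /forallPn[d /existsPn noq]; exists e, d.
apply/rowP => i; rewrite !mxE; set a := enum_val i => /=.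
have [/andP[pre1 pre2] | //] := boolP (prefix _ a.1 && prefix _ a.2).
have le1 : (size (rcons p.1 e) <= n)%N.
  exact: leq_trans (size_prefix pre1) (size_bseq _).
have le2 : (size (rcons p.2 d) <= m)%N.
  exact: leq_trans (size_prefix pre2) (size_bseq _).
have := noq (Bseq le1, Bseq le2); rewrite inE /= !eqxx !andbT => /existsPn.
by move/(_ a); rewrite enum_valP /preceq2 /= pre1 pre2.
Qed.

Lemma splits_Split2 (p : bitree n m) : splits A p -> p \in Split2 A.
Proof.
move=> sp; rewrite !inE sp andbT.
have /existsP[q /andP[]] := forallP (forallP sp true) true.
rewrite inE => /existsP[a /andP[aA /andP[q1 q2]]] /andP[/eqP e1 /eqP e2].
apply/existsP; exists a; rewrite aA /preceq2 /=.
by rewrite (prefix_trans _ q1) -?e1 ?(prefix_trans _ q2) -?e2 ?prefix_rcons.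
Qed.

Lemma ind_splits_in_span (p : bitree n m) : splits A p ->
  ind (rcons p.1 true) (rcons p.2 true) \in <<gens>>%VS.
Proof.
move=> sp; apply: memv_span; rewrite inE !mem_cat; apply/orP; right.
apply/orP; right; apply/orP; right; apply/mapP; exists p => //.
by rewrite mem_enum splits_Split2.
Qed.

Lemma ind_in_span_nilr (u : seq bool) :
  (size u <= n)%N -> ind u [::] \in <<gens>>%VS.
Proof.
elim/last_ind: u => [|u e IHu]; first by rewrite memv_span ?mem_head.
rewrite size_rcons => ltun.
have gen_u : ind (rcons u true) [::] \in <<gens>>%VS.
  apply: memv_span; rewrite inE !mem_cat; apply/orP; right.
  by apply/orP; left; apply/mapP; exists u; rewrite ?mem_words_lt.
by case: e => //; rewrite ind_rconsl // rpredB // IHu // ltnW.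
Qed.

Lemma ind_in_span_nill (v : seq bool) :
  (size v <= m)%N -> ind [::] v \in <<gens>>%VS.
Proof.
elim/last_ind: v => [|v d IHv]; first by rewrite memv_span ?mem_head.
rewrite size_rcons => ltvm.
have gen_v : ind [::] (rcons v true) \in <<gens>>%VS.
  apply: memv_span; rewrite inE !mem_cat; apply/orP; right; apply/orP; right.
  by apply/orP; left; apply/mapP; exists v; rewrite ?mem_words_lt.
by case: d => //; rewrite ind_rconsr // rpredB // IHv // ltnW.
Qed.

(** A double induction that removes last letters.  At [(ue, vd)] the functions
    with [u] in the first factor or [v] in the second are known to lie in the
    span, so that one child of [(u, v)] brings in all four. *)
Lemma ind_in_span (u v : seq bool) :
  (size u <= n)%N -> (size v <= m)%N -> ind u v \in <<gens>>%VS.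
Proof.
elim/last_ind: u v => [|u e IHu] v leun levm; first exact: ind_in_span_nill.
have ltun : (size u < n)%N by rewrite size_rcons in leun.
(* The letter [e] is generalized, because the step needs both children of [u]. *)
elim/last_ind: v e {leun} levm => [|v d IHv] e levm.
  by rewrite ind_in_span_nilr // size_rcons.
have ltvm : (size v < m)%N by rewrite size_rcons in levm.
have [e' [d' in_span]] :
    exists e' d', ind (rcons u e') (rcons v d') \in <<gens>>%VS.
  pose p : bitree n m := (Bseq (ltnW ltun), Bseq (ltnW ltvm)).
  have [sp | /ind_eq0_of_not_splits[e' [d' ind0]]] := boolP (splits A p).
    by exists true, true; apply: (ind_splits_in_span sp).
  by exists e', d'; rewrite [ind _ _]ind0 mem0v.
have in_span_d : ind (rcons u e') (rcons v d) \in <<gens>>%VS.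
  have [-> // | ne_d] := eqVneq d d'.
  have eq_d : ~~ d = d' by case: (d) (d') ne_d => [] [].
  by rewrite ind_rconsr // eq_d rpredB // IHv // ltnW.
have [-> // | ne_e] := eqVneq e e'.
have eq_e : ~~ e = e' by case: (e) (e') ne_e => [] [].
by rewrite ind_rconsl // eq_e rpredB // IHu // ltnW.
Qed.

Lemma ind_point (i : 'I_#|A|) :
  let a : bitree n m := enum_val i in ind a.1 a.2 = delta_mx 0 i.
Proof.
move=> a; apply/rowP => j; rewrite !mxE eqxx /=; congr ((nat_of_bool _)%:R).
have [i1 i2] := size_leaf (enum_valP i).
have [j1 j2] := size_leaf (enum_valP j).
rewrite !prefix_eq_size ?i1 ?i2 ?j1 ?j2 // !val_eqE.
by rewrite -(inj_eq enum_val_inj) [RHS]eq_sym.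
Qed.

Lemma span_gens : <<gens>>%VS = fullv.
Proof.
apply/eqP; rewrite eqEsubv subvf; apply/subvP => f _.
rewrite (row_sum_delta f); apply: rpred_sum => i _; apply: rpredZ.
by rewrite -ind_point ind_in_span ?size_bseq.
Qed.

Lemma card_le_size_gens : (#|A| <= size gens)%N.
Proof.
by have := dim_span gens; rewrite span_gens dimvf /dim /= mul1n.
Qed.

End Spanning.

Theorem proposition3p2 (n m : nat) (A : {set bitree n m})
    (hA : A \subset bileaves n m) :
  #|A|%:Z - (2%:Z ^+ n + 2%:Z ^+ m - 1) <= #|Split2 A|%:Z.
Proof.
have pow2 k : 2%:Z ^+ k = (size (words_lt k)).+1%:Z.
  by rewrite size_words_lt -[RHS]natz natrX.
have := card_le_size_gens hA.
rewrite /= !size_cat !size_map -cardE !pow2.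
move: {pow2} #|A| #|Split2 A| (size _) (size _) => a s k l; lia.
Qed.
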